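(* Let $(R,\mathfrak{m},\mathbf{k})$ be a complete Noetherian local domain (not necessarily normal) of mixed characteristic $p>0$ with perfect residue field $\mathbf{k}$ of characteristic $p$ and coefficient ring $W(\mathbf{k})$, whose uniformizer is denoted $\pi_{W(\mathbf{k})}$. Let $x_0,\ldots,x_d$ be a set of minimal generators of $\mathfrak{m}$, and assume: (1) if $\pi_{W(\mathbf{k})}\in\mathfrak{m}^2$, we put $\mathbf{x}_{\widetilde a}=\sum_{i=0}^d\widetilde a_ix_i$; (2) if $\pi_{W(\mathbf{k})}\notin\mathfrak{m}^2$, we put $x_0=\pi_{W(\mathbf{k})}$ and $\mathbf{x}_{\widetilde a}=\widetilde a_0\pi_{W(\mathbf{k})}+\sum_{i=1}^d\widetilde a_ix_i$. Suppose that $\mathbf{x}_{\widetilde a}=u\,\mathbf{x}_{\widetilde a'}$ for some $a,a'\in\theta_{W(\mathbf{k})}(\mathbb{P}^d(\mathbf{k}))\subseteq\mathbb{P}^d(W(\mathbf{k}))$ and some $u\in R^\times$. Then $u\in W(\mathbf{k})^\times$.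
   Context: A local domain is of mixed characteristic $p>0$ if its fraction field has characteristic $0$ and its residue field has characteristic $p$. $W(\mathbf{k})$ is the ring of ($p$-typical) Witt vectors, a complete discrete valuation ring with uniformizer $\pi_{W(\mathbf{k})}$, $(\pi_{W(\mathbf{k})})=(p)$; that it is a coefficient ring of $R$ means that an injection $W(\mathbf{k})\hookrightarrow R$ inducing an isomorphism of residue fields is fixed. $\mathbb{P}^d(W(\mathbf{k}))$ is the set of classes of tuples in $W(\mathbf{k})^{d+1}$ with at least one unit coordinate, modulo simultaneous multiplication by units; a lift $\widetilde a=(\widetilde a_0,\ldots,\widetilde a_d)$ of $a$ is a representing tuple (with some unit coordinate). With $[-]:\mathbf{k}\to W(\mathbf{k})$ the Teichmüller map, $\theta_{W(\mathbf{k})}(b_0:\cdots:b_d)=([b_0]:\cdots:[b_d])$. The field $\mathbf{k}$ may be finite. *)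

(* Defs.v *)
From HB Require Import structures.
From mathcomp Require Import all_boot all_order all_algebra finmap generic_quotient.
From mathcomp Require Import boolp classical_sets.
From mathcomp.multinomials Require Import monalg.

Set Implicit Arguments.
Unset Strict Implicit.
Unset Printing Implicit Defensive.

Import Order.TTheory GRing.Theory Num.Theory.
Local Open Scope ring_scope.

Section Ghost.
Variables (p : nat) (B : comNzRingType).
Implicit Types x y : nat -> B.

(* The n-th Witt polynomial w_n(x_0, ..., x_n) = sum_i p^i x_i^(p^(n-i)). *)
Definition ghost x n : B := \sum_(i < n.+1) p%:R ^+ i * x i ^+ (p ^ (n - i)).

Lemma ghostS x n :
  ghost x n.+1 = \sum_(i < n.+1) p%:R ^+ i * x i ^+ (p ^ (n.+1 - i))
                 + p%:R ^+ n.+1 * x n.+1.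
Proof. by rewrite /ghost big_ord_recr /= subnn expn0 expr1. Qed.

Lemma ghostSX x n :
  ghost x n.+1 = ghost (fun i => x i ^+ p) n + p%:R ^+ n.+1 * x n.+1.
Proof.
rewrite ghostS; congr (_ + _); apply: eq_bigr => i _.
by rewrite -exprM -expnS subSn // leq_ord.
Qed.

Lemma ghost0 x : ghost x 0 = x 0%N.
Proof. by rewrite /ghost big_ord1 expr0 mul1r subn0 expn0 expr1. Qed.

Lemma eq_ghost x y n : (forall i, (i <= n)%N -> x i = y i) ->
  ghost x n = ghost y n.
Proof. by move=> e; apply: eq_bigr => i _; rewrite e // -ltnS. Qed.

Lemma ghost_inj x y n :
    (forall a : B, p%:R * a = 0 -> a = 0) ->
    (forall i, (i <= n)%N -> ghost x i = ghost y i) ->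
  forall i, (i <= n)%N -> x i = y i.
Proof.
move=> tf; elim: n => [|n IH] eg i; first by rewrite leqn0 => /eqP->; have := eg _ (leqnn 0%N); rewrite !ghost0.
have {}IH : forall j, (j <= n)%N -> x j = y j.
  by apply: IH => j lejn; apply: eg; apply: leqW.
rewrite leq_eqVlt => /predU1P[->|]; last by apply: IH.
have := eg _ (leqnn n.+1); rewrite !ghostS.
rewrite (eq_bigr (fun j : 'I_n.+1 => p%:R ^+ j * y j ^+ (p ^ (n.+1 - j)))); last first.
  by move=> j _; rewrite IH // -ltnS.
move/addrI/eqP; rewrite -subr_eq0 -mulrBr => /eqP e; apply: subr0_eq; move: e.
move: (_ - _) => z; elim: n.+1 => [|q IHq]; first by rewrite expr0 mul1r.
by rewrite exprS -mulrA => /tf/IHq.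
Qed.

Definition teich_seq (b : B) : nat -> B := fun n => if n == 0%N then b else 0.

Lemma ghost_teich b n : prime p -> ghost (teich_seq b) n = b ^+ (p ^ n).
Proof.
move=> p_pr; rewrite /ghost big_ord_recl expr0 mul1r subn0 big1 ?addr0 // => i _.
by rewrite /teich_seq /= expr0n expn_eq0 -leqn0 leqNgt prime_gt0 // mulr0.
Qed.

End Ghost.

Lemma rmorph_ghost p (A B : comNzRingType) (f : {rmorphism A -> B}) x n :
  f (ghost p x n) = ghost p (f \o x) n.
Proof.
rewrite rmorph_sum; apply: eq_bigr => i _.
by rewrite rmorphM !rmorphXn rmorph_nat.
Qed.

Section Congruence.
Variables (p : nat) (p_pr : prime p) (B : comNzRingType).
Implicit Types a b c : B.

Definition cong n a b := exists r, a = b + p%:R ^+ n * r.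

Lemma cong_refl n a : cong n a a. Proof. by exists 0; rewrite mulr0 addr0. Qed.

Lemma cong_sym n a b : cong n a b -> cong n b a.
Proof. by move=> [r ->]; exists (- r); rewrite mulrN addrK. Qed.

Lemma cong_trans n b a c : cong n a b -> cong n b c -> cong n a c.
Proof. by move=> [r ->] [s ->]; exists (s + r); rewrite -addrA mulrDr. Qed.

Lemma congD n a b a' b' : cong n a b -> cong n a' b' -> cong n (a + a') (b + b').
Proof. by move=> [r ->] [s ->]; exists (r + s); rewrite mulrDr addrACA. Qed.

Lemma congN n a b : cong n a b -> cong n (- a) (- b).
Proof. by move=> [r ->]; exists (- r); rewrite mulrN opprD. Qed.

Lemma congMl n a b c : cong n a b -> cong n (c * a) (c * b).
Proof. by move=> [r ->]; exists (c * r); rewrite mulrDr mulrCA. Qed.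

Lemma congM n a b a' b' : cong n a b -> cong n a' b' -> cong n (a * a') (b * b').
Proof.
move=> e e'; apply: cong_trans (congMl _ e') _.
by rewrite ![_ * b']mulrC; apply: congMl.
Qed.

Lemma congX n a b e : cong n a b -> cong n (a ^+ e) (b ^+ e).
Proof.
move=> eab; elim: e => [|e IH]; first exact: cong_refl.
by rewrite !exprS; apply: congM.
Qed.

Lemma cong_sum n (I : finType) (F G : I -> B) :
  (forall i, cong n (F i) (G i)) -> cong n (\sum_i F i) (\sum_i G i).
Proof.
move=> e; elim/big_ind2: _ => // [|? ? ? ? h h']; first exact: cong_refl.
exact: congD.
Qed.

Lemma cong_scale i n a b : cong n a b -> cong (i + n) (p%:R ^+ i * a) (p%:R ^+ i * b).
Proof. by move=> [r ->]; exists r; rewrite mulrDr mulrA exprD. Qed.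

Lemma cong_frobD a b : cong 1 ((a + b) ^+ p) (a ^+ p + b ^+ p).
Proof.
have [q epq] : exists q, p = q.+1 by exists p.-1; rewrite prednK ?prime_gt0.
rewrite exprDn epq big_ord_recr big_ord_recl /= -epq.
rewrite subnn subn0 bin0 binn !expr0 mul1r mulr1 !mulr1n addrAC.
exists (\sum_(i < q) (a ^+ (p - i.+1) * b ^+ i.+1) *+ ('C(p, i.+1) %/ p)).
congr (_ + _); rewrite expr1 mulr_sumr; apply: eq_bigr => i _.
rewrite /bump /= add1n mulr_natl -mulrnA divnK // prime_dvd_bin //.
by rewrite /= epq ltnS ltn_ord.
Qed.

Lemma cong_lift n a b : cong n.+1 a b -> cong n.+2 (a ^+ p) (b ^+ p).
Proof.
move=> [r eab]; have [t et] : cong 1 (\sum_(i < p) a ^+ (p.-1 - i) * b ^+ i) 0.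
  apply: cong_trans (_ : cong 1 (\sum_(i < p) b ^+ p.-1) 0); last first.
    by exists (b ^+ p.-1); rewrite sumr_const card_ord add0r expr1 mulr_natl.
  apply: cong_sum => i; have -> : p.-1 = (p.-1 - i + i)%N.
    by rewrite subnK // -ltnS (ltn_predK (prime_gt0 p_pr)).
  rewrite addnK exprD ![_ * b ^+ i]mulrC; apply/congMl/congX.
  by exists (p%:R ^+ n * r); rewrite mulrA -exprD.
exists (r * t); apply/eqP; rewrite addrC -subr_eq subrXX et add0r eab addrAC subrr add0r.
by rewrite mulrACA -exprD addn1.
Qed.

Lemma cong_liftX n a b : cong 1 a b -> cong n.+1 (a ^+ (p ^ n)) (b ^+ (p ^ n)).
Proof.
move=> e; elim: n => [|n IH]; first by rewrite !expr1.
by rewrite expnSr !exprM; apply: cong_lift.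
Qed.

End Congruence.

Section Dwork.
Variables (p : nat) (p_pr : prime p) (A : comNzRingType) (phi : {rmorphism A -> A}).
Hypothesis A_tf : forall a : A, p%:R * a = 0 -> a = 0.
Hypothesis phi_cong : forall a : A, cong p 1 (phi a) (a ^+ p).

(* Dwork's congruences: they characterize the sequences of ghost components, and
   the sequence of coordinates is then unique since A has no p-torsion. *)
Definition dwork (g : nat -> A) := forall n, cong p n.+1 (g n.+1) (phi (g n)).

Lemma dworkD g h : dwork g -> dwork h -> dwork (fun n => g n + h n).
Proof. by move=> dg dh n; rewrite rmorphD; apply: congD. Qed.

Lemma dworkN g : dwork g -> dwork (fun n => - g n).
Proof. by move=> dg n; rewrite rmorphN; apply: congN. Qed.

Lemma dworkM g h : dwork g -> dwork h -> dwork (fun n => g n * h n).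
Proof. by move=> dg dh n; rewrite rmorphM; apply: congM. Qed.

Lemma dwork_lift g : dwork g -> exists s, forall n, ghost p s n = g n.
Proof.
move=> dg; have ex n : exists s, forall i, (i <= n)%N -> ghost p s i = g i.
  elim: n => [|n [s es]].
    by exists (fun=> g 0%N) => i; rewrite leqn0 => /eqP->; rewrite ghost0.
  have [r er] : cong p n.+1 (g n.+1) (ghost p (fun i => s i ^+ p) n).
    apply: cong_trans (dg n) _; rewrite -es // (rmorph_ghost p phi).
    apply: cong_sum => -[i /= lei]; rewrite -[X in cong _ X](subnKC lei) addSnnS.
    by apply: cong_scale; apply: cong_liftX => //; apply: phi_cong.
  exists (fun i => if (i <= n)%N then s i else r) => i.
  rewrite leq_eqVlt => /predU1P[->|]; last first.
    rewrite ltnS => lei; rewrite -(es i lei); apply: eq_ghost => j lej.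
    by rewrite (leq_trans lej lei).
  have eg : ghost p (fun i => (if (i <= n)%N then s i else r) ^+ p) n =
      ghost p (fun i => s i ^+ p) n by apply: eq_ghost => j lej; rewrite lej.
  by rewrite [LHS]ghostSX ltnn er eg.
pose t n := sval (cid (ex n)).
have et n i : (i <= n)%N -> ghost p (t n) i = g i by rewrite /t; case: cid => s /=; apply.
exists (fun n => t n n) => n; rewrite -(et n n (leqnn n)); apply: eq_ghost => i lei.
apply: (ghost_inj A_tf _ (leqnn i)) => j lej.
by rewrite (et i j lej) (et n j (leq_trans lej lei)).
Qed.

End Dwork.

(* The polynomial ring Z[X_(j,i)]; the X_(j,i), i >= 0, form the j-th generic
   sequence of coordinates. *)
Local Notation pvar := (nat * nat)%type.
Local Notation zpoly := {malg int[{cmonom pvar}]}.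

Section Evaluation.
Variables (B : comNzRingType) (v : pvar -> B).

Definition meval (m : {cmonom pvar}) : B := \prod_(i <- finsupp m) v i ^+ m i.

Lemma mevalEw (d : {fset pvar}) (m : {cmonom pvar}) : (finsupp m `<=` d)%fset ->
  meval m = \prod_(i <- d) v i ^+ m i.
Proof.
move=> le; rewrite /meval (big_fset_incl _ le) // => i _.
by rewrite -cmE_neq0 negbK => /eqP->.
Qed.

Lemma meval_multiplicative : mmorphism meval.
Proof.
split=> [m1 m2|]; last by rewrite /meval mdom1 big_seq_fset0.
rewrite (mevalEw (m := m1) (d := finsupp (mmul m1 m2))) ?mdomD ?fsubsetUl //.
rewrite (mevalEw (m := m2) (d := finsupp (mmul m1 m2))) ?mdomD ?fsubsetUr //.
by rewrite /meval mdomD -big_split; apply: eq_bigr => i _; rewrite cmM exprD.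
Qed.

HB.instance Definition _ :=
  isMultiplicative.Build {cmonom pvar} B meval meval_multiplicative.

Definition zeval : zpoly -> B := mmap intr meval.

HB.instance Definition _ := GRing.RMorphism.on zeval.

Lemma zeval_X j i : zeval << ucm (j, i) >> = v (j, i).
Proof.
by rewrite /zeval mmapU mul1r /= /meval mdomU big_seq_fset1 cmUU expr1.
Qed.

End Evaluation.

Lemma zeval_comp (A B : comNzRingType) (f : {rmorphism A -> B}) v g :
  f (zeval v g) = zeval (f \o v) g.
Proof.
rewrite /zeval !mmapE rmorph_sum; apply: eq_bigr => m _.
rewrite rmorphM /= rmorph_int rmorph_prod; congr (_ * _).
by apply: eq_bigr => i _; rewrite rmorphXn.
Qed.

Lemma zpoly_ind (T : zpoly -> Prop) :
    T 0 -> T 1 -> (forall a b, T a -> T b -> T (a + b)) -> (forall a, T a -> T (- a)) ->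
    (forall a b, T a -> T b -> T (a * b)) -> (forall m, T << m >>) ->
  forall g, T g.
Proof.
move=> T0 T1 TD TN TM TU g; have Tnat n : T n%:R.
  by elim: n => [|n IH]; [exact: T0 | rewrite mulrS; exact: TD].
have Tint (z : int) : T z%:~R.
  case: z => n; first exact: Tnat.
  by rewrite NegzE rmorphN; apply: TN; exact: Tnat.
rewrite (monalgE g); apply: (big_ind T T0 TD) => m _.
have -> : << g@_m *g m >> = (g@_m)%:~R * << m >> :> zpoly; last exact: (TM _ _ (Tint _) (TU _)).
by rewrite mulrzl -raddfMz intz.
Qed.

Section FrobeniusLift.
Variables (p : nat) (p_pr : prime p).

Lemma zpoly_torsionfree (a : zpoly) : p%:R * a = 0 -> a = 0.
Proof.
move=> e; apply/malgP => m; rewrite mcoeff0; apply/eqP.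
have /eqP := congr1 (mcoeff m) e.
by rewrite mulr_natl mcoeffMn mcoeff0 mulrn_eq0 eqn0Ngt (prime_gt0 p_pr).
Qed.

(* The lift of Frobenius X_(j,i) |-> X_(j,i)^p. *)
Definition frob_mon (m : {cmonom pvar}) : zpoly := << m >> ^+ p.

Lemma frob_mon_multiplicative : mmorphism frob_mon.
Proof.
have mulU (m1 m2 : {cmonom pvar}) : << (mmul m1 m2) >> = << m1 >> * << m2 >> :> zpoly.
  by rewrite malgM_def fgmulUU mulr1.
by split=> [m1 m2|]; rewrite /frob_mon ?mulU ?exprMn // expr1n.
Qed.

HB.instance Definition _ :=
  isMultiplicative.Build {cmonom pvar} zpoly frob_mon frob_mon_multiplicative.

Definition zfrob : zpoly -> zpoly := mmap intr frob_mon.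

HB.instance Definition _ := GRing.RMorphism.on zfrob.

Lemma zfrob_X j i : zfrob << ucm (j, i) >> = << ucm (j, i) >> ^+ p.
Proof. by rewrite /zfrob mmapU mul1r. Qed.

Lemma zfrob_cong g : cong p 1 (zfrob g) (g ^+ p).
Proof.
pose T g := cong p 1 (zfrob g) (g ^+ p).
have X0 : 0 ^+ p = 0 :> zpoly by rewrite expr0n eqn0Ngt prime_gt0.
have T0 : T 0 by rewrite /T rmorph0 X0; apply: cong_refl.
have TD a b : T a -> T b -> T (a + b).
  move=> Ta Tb; rewrite /T rmorphD; apply: cong_trans (congD Ta Tb) _.
  exact/cong_sym/cong_frobD.
have TN a : T a -> T (- a).
  move=> Ta; have := cong_frobD p_pr a (- a); rewrite subrr X0 => h.
  by have := congD (congN Ta) h; rewrite addr0 addKr /T rmorphN.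
have TM a b : T a -> T b -> T (a * b).
  by move=> Ta Tb; rewrite /T rmorphM exprMn; exact: (congM Ta Tb).
have T1 : T 1 by rewrite /T rmorph1 expr1n; apply: cong_refl.
have TU m : T << m >> by rewrite /T /zfrob mmapU mul1r; exact: cong_refl.
exact: (zpoly_ind T0 T1 TD TN TM TU g).
Qed.

End FrobeniusLift.

(* What is used of Z[X_(j,i)].  The computations below are carried out for an
   abstract such ring A, as unification tends to unfold the operations of
   {malg _}. *)
Record generic_ring (p : nat) := GenericRing {
  gr_ring :> comNzRingType;
  gr_X : nat -> nat -> gr_ring;
  gr_eval : forall B : comNzRingType, (pvar -> B) -> {rmorphism gr_ring -> B};
  gr_frob : {rmorphism gr_ring -> gr_ring};
  gr_eval_X : forall (B : comNzRingType) (v : pvar -> B) j i,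
    gr_eval v (gr_X j i) = v (j, i);
  gr_eval_comp : forall (A B : comNzRingType) (f : {rmorphism A -> B}) (v : pvar -> A) g,
    f (gr_eval v g) = gr_eval (f \o v) g;
  gr_torsionfree : forall g : gr_ring, p%:R * g = 0 -> g = 0;
  gr_frob_X : forall j i, gr_frob (gr_X j i) = gr_X j i ^+ p;
  gr_frob_cong : forall g : gr_ring, cong p 1 (gr_frob g) (g ^+ p) }.

Definition wpoly (p : nat) (p_pr : prime p) : generic_ring p :=
  @GenericRing p zpoly (fun j i => << ucm (j, i) >>)
    (fun B v => zeval v) (zfrob p) zeval_X zeval_comp
    (zpoly_torsionfree p_pr) (zfrob_X p) (zfrob_cong p_pr).

Section WittPolynomials.
Variables (p : nat) (p_pr : prime p) (A : generic_ring p).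
Local Notation X := (@gr_X p A).
Local Notation frob := (@gr_frob p A).

Lemma dworkX j : dwork p frob (ghost p (X j)).
Proof.
move=> n; exists (X j n.+1); rewrite [LHS]ghostSX rmorph_ghost.
by have -> : frob \o X j = (fun i => X j i ^+ p) by apply/funext => i; exact: gr_frob_X.
Qed.

(* Addition, opposite and multiplication of Witt vectors are given by the
   integral polynomials lifting the corresponding operation on the ghost
   components of the generic sequences X_0 and X_1. *)
Definition witt_add_poly : nat -> A :=
  sval (cid (dwork_lift p_pr (@gr_torsionfree p A) (@gr_frob_cong p A) (dworkD (dworkX 0) (dworkX 1)))).
Definition witt_opp_poly : nat -> A :=
  sval (cid (dwork_lift p_pr (@gr_torsionfree p A) (@gr_frob_cong p A) (dworkN (dworkX 0)))).
Definition witt_mul_poly : nat -> A :=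
  sval (cid (dwork_lift p_pr (@gr_torsionfree p A) (@gr_frob_cong p A) (dworkM (dworkX 0) (dworkX 1)))).

Lemma witt_add_polyE n :
  ghost p witt_add_poly n = ghost p (X 0) n + ghost p (X 1) n.
Proof. by rewrite /witt_add_poly; case: cid. Qed.
Lemma witt_opp_polyE n : ghost p witt_opp_poly n = - ghost p (X 0) n.
Proof. by rewrite /witt_opp_poly; case: cid. Qed.
Lemma witt_mul_polyE n :
  ghost p witt_mul_poly n = ghost p (X 0) n * ghost p (X 1) n.
Proof. by rewrite /witt_mul_poly; case: cid. Qed.

End WittPolynomials.

Definition wenv (B : comNzRingType) (s : seq (nat -> B)) (v : pvar) : B :=
  nth (fun=> 0) s v.1 v.2.

HB.lock Definition wadd (p : nat) (p_pr : prime p) (A : generic_ring p)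
    (B : comNzRingType) (x y : nat -> B) (n : nat) : B :=
  gr_eval A (wenv [:: x; y]) (witt_add_poly p_pr A n).
HB.lock Definition wopp (p : nat) (p_pr : prime p) (A : generic_ring p)
    (B : comNzRingType) (x : nat -> B) (n : nat) : B :=
  gr_eval A (wenv [:: x]) (witt_opp_poly p_pr A n).
HB.lock Definition wmul (p : nat) (p_pr : prime p) (A : generic_ring p)
    (B : comNzRingType) (x y : nat -> B) (n : nat) : B :=
  gr_eval A (wenv [:: x; y]) (witt_mul_poly p_pr A n).

Section WittOperations.
Variables (p : nat) (p_pr : prime p) (A : generic_ring p) (B : comNzRingType).
Local Notation X := (@gr_X p A).
Local Notation peval := (@gr_eval p A _).
Implicit Types x y z : nat -> B.

Lemma gr_eval_seq (s : seq (nat -> B)) j : peval (wenv s) \o X j = nth (fun=> 0) s j.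
Proof. by apply/funext => i /=; rewrite gr_eval_X. Qed.

Lemma peval_ghost (s : seq (nat -> B)) j n :
  peval (wenv s) (ghost p (X j) n) = ghost p (nth (fun=> 0) s j) n.
Proof. by rewrite rmorph_ghost gr_eval_seq. Qed.

Lemma ghost_wadd x y n : ghost p (wadd p_pr A x y) n = ghost p x n + ghost p y n.
Proof.
rewrite unlock -[LHS](rmorph_ghost p (peval (wenv [:: x; y]))) witt_add_polyE.
by rewrite rmorphD /= !peval_ghost.
Qed.

Lemma ghost_wopp x n : ghost p (wopp p_pr A x) n = - ghost p x n.
Proof.
rewrite unlock -[LHS](rmorph_ghost p (peval (wenv [:: x]))) witt_opp_polyE.
by rewrite rmorphN /= !peval_ghost.
Qed.

Lemma ghost_wmul x y n : ghost p (wmul p_pr A x y) n = ghost p x n * ghost p y n.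
Proof.
rewrite unlock -[LHS](rmorph_ghost p (peval (wenv [:: x; y]))) witt_mul_polyE.
by rewrite rmorphM /= !peval_ghost.
Qed.

Lemma ghost_wzero n : ghost p (fun=> 0 : B) n = 0.
Proof.
rewrite /ghost big1 // => i _.
by rewrite expr0n expn_eq0 eqn0Ngt prime_gt0 // mulr0.
Qed.

Lemma ghost_wone n : ghost p (teich_seq (1 : B)) n = 1.
Proof. by rewrite ghost_teich // expr1n. Qed.

End WittOperations.

Section WittFunctoriality.
Variables (p : nat) (p_pr : prime p) (G : generic_ring p).
Variables (A B : comNzRingType) (f : {rmorphism A -> B}).
Implicit Types x y : nat -> A.

Lemma comp_wenv s : f \o wenv s = wenv [seq f \o x | x <- s].
Proof.
apply/funext => -[j i]; rewrite /wenv /=.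
by elim: s j => [|x s IH] [|j] //=; rewrite rmorph0.
Qed.

Lemma comp_wadd x y : f \o wadd p_pr G x y = wadd p_pr G (f \o x) (f \o y).
Proof. by apply/funext => n; rewrite /= !wadd.unlock gr_eval_comp comp_wenv. Qed.
Lemma comp_wopp x : f \o wopp p_pr G x = wopp p_pr G (f \o x).
Proof. by apply/funext => n; rewrite /= !wopp.unlock gr_eval_comp comp_wenv. Qed.
Lemma comp_wmul x y : f \o wmul p_pr G x y = wmul p_pr G (f \o x) (f \o y).
Proof. by apply/funext => n; rewrite /= !wmul.unlock gr_eval_comp comp_wenv. Qed.
Lemma comp_wzero : f \o (fun=> 0 : A) = (fun=> 0 : B) :> (nat -> B).
Proof. by apply/funext => n /=; rewrite rmorph0. Qed.
Lemma comp_teich_seq a : f \o teich_seq a = teich_seq (f a).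
Proof. by apply/funext => -[|n] //=; rewrite rmorph0. Qed.

End WittFunctoriality.

Section WittAxioms.
Variables (p : nat) (p_pr : prime p) (A : generic_ring p).
Local Notation X := (@gr_X p A).

Lemma ghostP (x y : nat -> A) : ghost p x =1 ghost p y -> x = y.
Proof.
move=> e; apply/funext => n.
by apply: (ghost_inj (@gr_torsionfree p A) _ (leqnn n)) => i _; apply: e.
Qed.

Local Definition ghostE :=
  (ghost_wadd p_pr A, ghost_wopp p_pr A, ghost_wmul p_pr A, ghost_wzero p_pr, ghost_wone p_pr).

Variable B : comNzRingType.
Implicit Types x y z : nat -> B.
Local Notation add := (wadd p_pr A).
Local Notation opp := (wopp p_pr A).
Local Notation mul := (wmul p_pr A).
Local Notation zero := (fun=> 0).
Local Notation one := (teich_seq 1).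

(* An identity between Witt vectors over A may be checked on ghost
   components, and specializes to any ring by evaluation. *)
Local Ltac specialize_from s lem :=
  have := congr1 (fun u => @gr_eval p A _ (wenv s) \o u) lem;
  rewrite ?(comp_wadd, comp_wopp, comp_wmul, comp_wzero, comp_teich_seq, rmorph1)
    ?gr_eval_seq /=.

Lemma waddA : associative (@wadd p p_pr A B).
Proof.
move=> x y z; have h : add (X 0) (add (X 1) (X 2)) = add (add (X 0) (X 1)) (X 2).
  by apply: ghostP => n; rewrite !ghostE addrA.
by specialize_from [:: x; y; z] h.
Qed.

Lemma waddC : commutative (@wadd p p_pr A B).
Proof.
move=> x y; have h : add (X 0) (X 1) = add (X 1) (X 0).
  by apply: ghostP => n; rewrite !ghostE addrC.
by specialize_from [:: x; y] h.
Qed.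

Lemma wadd0 : left_id zero (@wadd p p_pr A B).
Proof.
move=> x; have h : add zero (X 0) = X 0.
  by apply: ghostP => n; rewrite !ghostE add0r.
by specialize_from [:: x] h.
Qed.

Lemma waddN : left_inverse zero (@wopp p p_pr A B) (@wadd p p_pr A B).
Proof.
move=> x; have h : add (opp (X 0)) (X 0) = zero.
  by apply: ghostP => n; rewrite !ghostE addNr.
by specialize_from [:: x] h.
Qed.

Lemma wmulA : associative (@wmul p p_pr A B).
Proof.
move=> x y z; have h : mul (X 0) (mul (X 1) (X 2)) = mul (mul (X 0) (X 1)) (X 2).
  by apply: ghostP => n; rewrite !ghostE mulrA.
by specialize_from [:: x; y; z] h.
Qed.

Lemma wmulC : commutative (@wmul p p_pr A B).
Proof.
move=> x y; have h : mul (X 0) (X 1) = mul (X 1) (X 0).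
  by apply: ghostP => n; rewrite !ghostE mulrC.
by specialize_from [:: x; y] h.
Qed.

Lemma wmul1 : left_id one (@wmul p p_pr A B).
Proof.
move=> x; have h : mul one (X 0) = X 0.
  by apply: ghostP => n; rewrite !ghostE mul1r.
by specialize_from [:: x] h.
Qed.

Lemma wmulDl : left_distributive (@wmul p p_pr A B) (@wadd p p_pr A B).
Proof.
move=> x y z; have h : mul (add (X 0) (X 1)) (X 2) =
    add (mul (X 0) (X 2)) (mul (X 1) (X 2)).
  by apply: ghostP => n; rewrite !ghostE mulrDl.
by specialize_from [:: x; y; z] h.
Qed.

Lemma wmul_teich (a b : B) : mul (teich_seq a) (teich_seq b) = teich_seq (a * b).
Proof.
have h : mul (teich_seq (X 0 0)) (teich_seq (X 1 0)) = teich_seq (X 0 0 * X 1 0).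
  by apply: ghostP => n; rewrite !ghostE !ghost_teich // exprMn.
specialize_from [:: (fun _ : nat => a); (fun _ : nat => b)] h.
by rewrite rmorphM /= !gr_eval_X.
Qed.

End WittAxioms.

Record witt (p : nat) (p_pr : prime p) (k : comNzRingType) :=
  Witt { witt_coord : nat -> k }.

Section WittRing.
Variables (p : nat) (p_pr : prime p) (k : comNzRingType).
Local Notation W := (witt p_pr k).
Implicit Types x y : W.

Lemma witt_coord_inj : injective (@witt_coord p p_pr k).
Proof. by move=> [x] [y] /= ->. Qed.

HB.instance Definition _ := gen_eqMixin W.
HB.instance Definition _ := gen_choiceMixin W.

Definition witt_zero : W := Witt p_pr (fun=> 0).
Definition witt_one : W := Witt p_pr (teich_seq 1).
Definition witt_add x y : W := Witt p_pr (wadd p_pr (wpoly p_pr) (witt_coord x) (witt_coord y)).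
Definition witt_opp x : W := Witt p_pr (wopp p_pr (wpoly p_pr) (witt_coord x)).
Definition witt_mul x y : W := Witt p_pr (wmul p_pr (wpoly p_pr) (witt_coord x) (witt_coord y)).

Lemma witt_addA : associative witt_add.
Proof. by move=> x y z; apply/witt_coord_inj/waddA. Qed.
Lemma witt_addC : commutative witt_add.
Proof. by move=> x y; apply/witt_coord_inj/waddC. Qed.
Lemma witt_add0 : left_id witt_zero witt_add.
Proof. by move=> x; apply/witt_coord_inj/wadd0. Qed.
Lemma witt_addN : left_inverse witt_zero witt_opp witt_add.
Proof. by move=> x; apply/witt_coord_inj/waddN. Qed.

HB.instance Definition _ :=
  GRing.isZmodule.Build W witt_addA witt_addC witt_add0 witt_addN.

Lemma witt_mulA : associative witt_mul.
Proof. by move=> x y z; apply/witt_coord_inj/wmulA. Qed.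
Lemma witt_mulC : commutative witt_mul.
Proof. by move=> x y; apply/witt_coord_inj/wmulC. Qed.
Lemma witt_mul1 : left_id witt_one witt_mul.
Proof. by move=> x; apply/witt_coord_inj/wmul1. Qed.
Lemma witt_mulDl : left_distributive witt_mul witt_add.
Proof. by move=> x y z; apply/witt_coord_inj/wmulDl. Qed.
Lemma witt_one_neq0 : witt_one != 0.
Proof. by apply/eqP => /(congr1 (fun x => witt_coord x 0%N))/eqP; rewrite /= oner_eq0. Qed.

HB.instance Definition _ := GRing.Zmodule_isComNzRing.Build W
  witt_mulA witt_mulC witt_mul1 witt_mulDl witt_one_neq0.

Definition witt_unit : pred W := fun x => `[< exists y, y * x = 1 >].
Definition witt_inv x : W :=
  if pselect (exists y, y * x = 1) is left h then sval (cid h) else x.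

Lemma witt_mulVx : {in witt_unit, left_inverse 1 witt_inv *%R}.
Proof.
move=> x /asboolP h; rewrite /witt_inv; case: pselect => // h'.
by case: cid.
Qed.
Lemma witt_unitP x y : y * x = 1 -> witt_unit x.
Proof. by move=> h; apply/asboolP; exists y. Qed.
Lemma witt_inv_out : {in [predC witt_unit], witt_inv =1 id}.
Proof.
move=> x /asboolPn h; rewrite /witt_inv; case: pselect => // h'.
Qed.

HB.instance Definition _ := GRing.ComNzRing_hasMulInverse.Build W
  witt_mulVx witt_unitP witt_inv_out.

Definition witt_res x : k := witt_coord x 0.

Lemma witt_res_is_zmod_morphism : zmod_morphism witt_res.
Proof.
move=> x y; have := ghost_wadd p_pr (wpoly p_pr) (witt_coord x) (witt_coord (- y)) 0.
have := ghost_wopp p_pr (wpoly p_pr) (witt_coord y) 0; rewrite !ghost0 => e1 e2.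
by rewrite /witt_res [LHS]e2 [X in _ + X = _]e1.
Qed.

Lemma witt_res_is_monoid_morphism : monoid_morphism witt_res.
Proof.
split=> // x y; have := ghost_wmul p_pr (wpoly p_pr) (witt_coord x) (witt_coord y) 0.
by rewrite !ghost0.
Qed.

HB.instance Definition _ := GRing.isZmodMorphism.Build W k witt_res
  witt_res_is_zmod_morphism.
HB.instance Definition _ := GRing.isMonoidMorphism.Build W k witt_res
  witt_res_is_monoid_morphism.

Definition teich (b : k) : W := Witt p_pr (teich_seq b).

Lemma teichM : {morph teich : a b / a * b}.
Proof. by move=> a b; apply: witt_coord_inj; rewrite /= -(wmul_teich p_pr (wpoly p_pr)). Qed.

Lemma teich1 : teich 1 = 1. Proof. by []. Qed.

End WittRing.

Arguments teich {p} p_pr {k} b.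

Lemma teich_unit (p : nat) (p_pr : prime p) (k : fieldType) (b : k) :
  b != 0 -> teich p_pr b \is a GRing.unit.
Proof.
move=> b0; apply/asboolP; exists (teich p_pr b^-1).
by rewrite -teichM mulVf.
Qed.

Section ProjectiveSpace.
Variables (d : nat) (S : comUnitRingType).

Definition has_unit_coord (a : 'rV[S]_d.+1) : bool :=
  [exists i, a 0 i \is a GRing.unit].

Definition proj_tuple := {a : 'rV[S]_d.+1 | has_unit_coord a}.

Definition proj_rel (a b : proj_tuple) : bool :=
  `[< exists2 c : S, c \is a GRing.unit & val b = c *: val a >].

Lemma proj_rel_equiv : equiv_class_of proj_rel.
Proof.
split=> [a|a b|b a c].
- by apply/asboolP; exists 1; rewrite ?unitr1 ?scale1r.
- apply/asboolP/asboolP => -[c Uc e]; exists c^-1; rewrite ?unitrV // e scalerA;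
  by rewrite mulVr // scale1r.
- move=> /asboolP[e Ue eb] /asboolP[f Uf ec]; apply/asboolP; exists (f * e).
    by rewrite unitrM Uf.
  by rewrite ec eb scalerA.
Qed.

Canonical proj_equiv := EquivRelPack proj_rel_equiv.

Definition proj := {eq_quot proj_equiv}%qT.

Definition proj_class (a : proj_tuple) : proj := \pi_proj%qT a.

Lemma proj_classP (a b : proj_tuple) :
  proj_class a = proj_class b <->
  exists2 c : S, c \is a GRing.unit & val b = c *: val a.
Proof.
split=> [/eqP|h]; first by rewrite eqmodE => /asboolP.
by apply/eqP; rewrite eqmodE; apply/asboolP.
Qed.

(* a is a representing tuple of the point P. *)
Definition is_lift (P : proj) (a : 'rV[S]_d.+1) : Prop :=
  exists Ha : has_unit_coord a, proj_class (exist _ a Ha) = P.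

End ProjectiveSpace.

Section TeichmullerPoints.
Variables (p : nat) (p_pr : prime p) (k : fieldType) (d : nat).

Lemma has_unit_coord_teich (b : 'rV[k]_d.+1) :
  has_unit_coord b -> has_unit_coord (map_mx (teich p_pr) b).
Proof.
move=> /existsP[i]; rewrite unitfE => bi.
by apply/existsP; exists i; rewrite mxE teich_unit.
Qed.

Definition teich_tuple (b : proj_tuple d k) : proj_tuple d (witt p_pr k) :=
  exist _ (map_mx (teich p_pr) (val b)) (has_unit_coord_teich (valP b)).

(* theta (b_0 : ... : b_d) = ([b_0] : ... : [b_d]); it does not depend on the
   representative, see theta_class. *)
Definition theta (P : proj d k) : proj d (witt p_pr k) :=
  proj_class (teich_tuple (repr P)).

Lemma theta_class (b : proj_tuple d k) :
  theta (proj_class b) = proj_class (teich_tuple b).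
Proof.
have /proj_classP[c Uc e] : proj_class (repr (proj_class b)) = proj_class b.
  exact: reprK.
apply/proj_classP; exists (teich p_pr c); first by rewrite teich_unit // -unitfE.
by apply/rowP => i; rewrite !mxE /= e mxE teichM.
Qed.

End TeichmullerPoints.

Local Open Scope classical_set_scope.

Section Ideals.
Variable R : comUnitRingType.
Implicit Types I J : set R.

Definition ideal I : Prop :=
  [/\ I 0, forall a b, I a -> I b -> I (a + b) & forall r a, I a -> I (r * a)].

Definition ideal_gen (n : nat) (f : 'I_n -> R) (J : {set 'I_n}) : set R :=
  [set z | exists c : 'I_n -> R, z = \sum_(i in J) c i * f i].

Definition ideal_mul I J : set R :=
  [set z | exists n (a b : 'I_n -> R),
     [/\ forall i, I (a i), forall i, J (b i) & z = \sum_i a i * b i]].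

Definition ideal_exp I (n : nat) : set R := iter n (ideal_mul I) [set: R].

Definition noetherian : Prop :=
  forall I, ideal I -> exists n (f : 'I_n -> R), I = ideal_gen f [set: 'I_n]%SET.

Definition local_ring (m : set R) : Prop :=
  ideal m /\ m = [set a | a \isn't a GRing.unit].

(* Bijectivity of R -> lim R / I^n: an element of the limit is represented by a
   sequence s with s_(n+1) = s_n mod I^n. *)
Definition adically_complete I : Prop :=
  (forall a, (forall n, ideal_exp I n a) -> a = 0) /\
  (forall s : nat -> R, (forall n, ideal_exp I n (s n.+1 - s n)) ->
     exists l, forall n, ideal_exp I n (l - s n)).

(* No proper subfamily of x generates I; in particular x has no repetition. *)
Definition minimal_generators (n : nat) (x : 'I_n -> R) (I : set R) : Prop :=
  ideal_gen x [set: 'I_n]%SET = I /\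
  forall J : {set 'I_n}, ideal_gen x J = I -> J = [set: 'I_n]%SET.

End Ideals.

(* k is perfect of characteristic p. *)
Definition perfect_field (p : nat) (k : fieldType) : Prop :=
  p \in [pchar k] /\ bijective (fun b : k => b ^+ p).

Definition residue_field (R : comUnitRingType) (m : set R) (k : fieldType)
    (res : {rmorphism R -> k}) : Prop :=
  (forall b, exists a, res a = b) /\ [set a | res a = 0] = m.

(* Here k is the residue field of R. *)
Definition mixed_char (p : nat) (R : idomainType) (k : fieldType) : Prop :=
  [pchar {fraction R}] =i pred0 /\ p \in [pchar k].

(* iota : W(k) -> R is injective, and the map it induces from the residue field
   k of W(k) to the residue field k of R is an isomorphism sigma. *)
Definition coefficient_ring (p : nat) (p_pr : prime p) (R : comUnitRingType)
    (k : fieldType) (res : {rmorphism R -> k})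
    (iota : {rmorphism witt p_pr k -> R}) : Prop :=
  injective iota /\
  exists2 sigma : {rmorphism k -> k}, bijective sigma &
    forall w, res (iota w) = sigma (witt_res w).

(* (pi) = (p) as ideals of W(k). *)
Definition uniformizer (p : nat) (p_pr : prime p) (k : fieldType)
    (pi : witt p_pr k) : Prop :=
  [set w | exists c, w = c * pi] = [set w | exists c, w = c * p%:R].

(* x_a = sum_i a_i x_i, for a tuple a in W(k)^(d+1) acting through iota. *)
Definition linear_form (p : nat) (p_pr : prime p) (R : comUnitRingType)
    (k : fieldType) (iota : {rmorphism witt p_pr k -> R}) (d : nat)
    (x : 'I_d.+1 -> R) (a : 'rV[witt p_pr k]_d.+1) : R :=
  \sum_i iota (a 0 i) * x i.

(* Main.v *)
(* Minimality of the generators forces the coefficients of any linear relation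
   between them to be nonunits.  Applied to x_a - u x_a' = 0, this shows that the
   residues of a and a' are proportional over k.  As a and a' are unit multiples
   of Teichmuller tuples and [-] is multiplicative, a = w a' for some w in W(k),
   hence w x_a' = u x_a', and x_a' <> 0 can be cancelled. *)
Require Import Defs.
From mathcomp Require Import all_boot all_order all_algebra.
From mathcomp Require Import boolp classical_sets.

Set Implicit Arguments.
Unset Strict Implicit.
Unset Printing Implicit Defensive.

Import Order.TTheory GRing.Theory Num.Theory.
Local Open Scope ring_scope.
Local Open Scope classical_set_scope.

(** If some [c j] were a unit, the relation could be solved for [x j], so the family without [x j]
    would still generate [I], against minimality. *)
Lemma minimal_generators_relation (R : comUnitRingType) (n : nat)
    (x : 'I_n -> R) (I : set R) (c : 'I_n -> R) :
  minimal_generators x I -> \sum_i c i * x i = 0 ->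
  forall i, c i \isn't a GRing.unit.
Proof.
move=> [<- min_x] rel j; apply/negP => Uc.
have /setP/(_ j) : [set~ j]%SET = [set: 'I_n]%SET; last by rewrite !inE eqxx.
apply: min_x; apply/seteqP; split=> z [f ->].
  exists (fun i => if i \in [set~ j]%SET then f i else 0).
  rewrite big_mkcond /=; apply: eq_big => i; first by rewrite inE.
  by rewrite (fun_if (fun t => t * x i)) mul0r.
(* Subtracting [f j / c j] times the relation leaves the sum unchanged and kills the coefficient at
   [j]. *)
exists (fun i => f i - f j * (c j)^-1 * c i).
have -> : \sum_(i in [set: 'I_n]%SET) f i * x i =
    \sum_i (f i - f j * (c j)^-1 * c i) * x i.
  rewrite (eq_bigl xpredT) => [|i]; last by rewrite inE.
  under [RHS]eq_bigr do rewrite mulrBl -!mulrA.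
  by rewrite sumrB -!mulr_sumr rel !mulr0 subr0.
rewrite (bigD1 j) //= divrK // subrr mul0r add0r.
by apply: eq_bigl => i; rewrite !inE.
Qed.

Lemma local_nonunitE (R : comUnitRingType) (m : set R) (k : fieldType)
    (res : {rmorphism R -> k}) (r : R) :
  local_ring m -> residue_field m res -> r \isn't a GRing.unit -> res r = 0.
Proof.
by move=> [_ mE] [_ resm] Nr; have : m r by [rewrite mE]; rewrite -resm.
Qed.

(** Two representatives of a point differ by a unit; here the given lift is compared with the
    Teichmuller tuple of the representative chosen by [theta]. *)
Lemma lift_theta (p : nat) (p_pr : prime p) (k : fieldType) (d : nat)
    (a : proj d (witt p_pr k)) (ta : 'rV[witt p_pr k]_d.+1) :
  range (@theta p p_pr k d) a -> is_lift a ta ->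
  exists (c : witt p_pr k) (b : 'rV[k]_d.+1),
    [/\ c \is a GRing.unit, has_unit_coord b &
        forall i, ta 0 i = c * teich p_pr (b 0 i)].
Proof.
move=> [P _ <-] [Uta /esym/proj_classP[c Uc /= ->]].
exists c, (val (repr P)); split=> //; first exact: valP.
by move=> i; rewrite !mxE.
Qed.

Theorem proposition5p1 (p : nat) (p_pr : prime p) (R : idomainType) (m : set R)
    (k : fieldType) (res : {rmorphism R -> k})
    (R_local : local_ring m)
    (R_noetherian : noetherian R)
    (R_complete : adically_complete m)
    (k_residue : residue_field m res)
    (R_mixed_char : mixed_char p R k)
    (k_perfect : perfect_field p k)
    (iota : {rmorphism witt p_pr k -> R})
    (W_coefficient_ring : coefficient_ring res iota)
    (pi : witt p_pr k) (pi_uniformizer : uniformizer pi)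
    (d : nat) (x : 'I_d.+1 -> R)
    (x_generators : minimal_generators x m)
    (x0_pi : ~ ideal_exp m 2 (iota pi) -> x ord0 = iota pi)
    (a a' : proj d (witt p_pr k))
    (a_theta : range (@theta p p_pr k d) a)
    (a'_theta : range (@theta p p_pr k d) a')
    (ta ta' : 'rV[witt p_pr k]_d.+1)
    (ta_lift : is_lift a ta) (ta'_lift : is_lift a' ta')
    (u : R) (u_unit : u \is a GRing.unit) :
  linear_form iota x ta = u * linear_form iota x ta' ->
  exists2 w : witt p_pr k, w \is a GRing.unit & u = iota w.
Proof.
move=> eq_lin.
have [_ [sigma sigma_bij sigmaE]] := W_coefficient_ring.
have [c [b [Uc _ taE]]] := lift_theta a_theta ta_lift.
have [c' [b' [Uc' /existsP[j Ub'j] ta'E]]] := lift_theta a'_theta ta'_lift.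
have [tau _ tauK] := sigma_bij.
have Urc : witt_res c != 0 by rewrite -unitfE rmorph_unit.
have Urc' : witt_res c' != 0 by rewrite -unitfE rmorph_unit.
(* [iota] induces [sigma], not necessarily the identity, on residue fields, so [res u] is pulled
   back by its inverse [tau]. After applying [sigma], the two sides are the residues of
   [iota (ta 0 i)] and [u * iota (ta' 0 i)]. *)
have resE i : witt_res c * b 0 i = tau (res u) * (witt_res c' * b' 0 i).
  apply: (bij_inj sigma_bij); rewrite [RHS]rmorphM /= tauK.
  have -> : witt_res c * b 0 i = witt_res (ta 0 i) by rewrite taE rmorphM.
  have -> : witt_res c' * b' 0 i = witt_res (ta' 0 i) by rewrite ta'E rmorphM.
  rewrite -!sigmaE -rmorphM; apply/eqP; rewrite -subr_eq0 -rmorphB; apply/eqP.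
  apply: (local_nonunitE R_local k_residue).
  apply: (minimal_generators_relation
            (c := fun i => iota (ta 0 i) - u * iota (ta' 0 i)) x_generators).
  under eq_bigr do rewrite mulrBl -mulrA.
  by rewrite sumrB -mulr_sumr; apply/eqP; rewrite subr_eq0; apply/eqP.
(* Otherwise it would be a relation whose coefficient at [j] is a unit. *)
have lin'_neq0 : linear_form iota x ta' != 0.
  apply/eqP => /(minimal_generators_relation x_generators)/(_ j)/negP; apply.
  by rewrite ta'E rmorph_unit // unitrM Uc' teich_unit // -unitfE.
(* The ratio of [b] to [b'] read off from [resE]; it is nonzero because [u] is a unit. *)
pose e := tau (res u) * witt_res c' / witt_res c.
have e_neq0 : e != 0.
  rewrite !mulf_neq0 ?invr_eq0 //; apply: contraTneq u_unit => tau0.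
  have resu0 : res u = 0 by rewrite -(tauK (res u)) tau0 rmorph0.
  by apply/negP => /(rmorph_unit res); rewrite resu0 unitr0.
have bE i : b 0 i = e * b' 0 i.
  by apply: (mulfI Urc); rewrite resE [LHS]mulrA [RHS]mulrA [witt_res c * e]mulrC divfK.
(* Chosen so that [ta = w *: ta']: each [c * [e * b'_i]] equals [w * (c' * [b'_i])]. *)
pose w := c * teich p_pr e / c'.
exists w; first by rewrite !unitrM unitrV Uc Uc' teich_unit.
apply: (mulIf lin'_neq0); rewrite -eq_lin /linear_form mulr_sumr.
apply: eq_bigr => i _; rewrite mulrA -rmorphM; congr (iota _ * _).
by rewrite taE ta'E bE teichM [LHS]mulrA [RHS]mulrA divrK.
Qed.
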